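(* Let $\varphi=(1+\sqrt5)/2$. In a spherical pan (closed ball) of any dimension $d\ge2$, with strictly decreasing positive outer radii $r_i$ and independent hole radii $0\le h_i<r_i$, every descending greedy execution on at most five rings returns the lex-max set when $\rho\le\varphi$. Thus, if $\tau_{\le5,d}$ denotes the infimum of $\rho$ over all such instances with at most five rings on which some descending greedy execution fails to place the lex-max set, then $\tau_{\le5,d}=\varphi$, and the infimum is not attained. The corresponding infimum over instances with exactly five rings is also $\varphi$.
   Context: Model. The pan is a closed ball of radius $R$ in $\mathbb R^d$. An inventory is a finite list of outer radii $r_1>r_2>\dots>r_n>0$, ring $i$ having a hole that is a ball of radius $h_i$, with $0\le h_i<r_i$ arbitrary. A placement of a set $S$ of rings is a forest: each ring of $S$ has as parent either the pan or another ring of $S$ (whose hole radius is at least the child's outer radius), and the children of each common parent must be packable in the parent's region (the pan, or the hole ball of radius $h_i$ of ring $i$), i.e. closed balls having the children's outer radii can be positioned inside that region with pairwise disjoint interiors. Feasibility depends only on the parent assignment. $S$ is feasible if it has a placement. The lex-max set $L$ is defined by scanning $i=1,\dots,n$ and including $i$ whenever $(L\cap\{1,\dots,i-1\})\cup\{i\}$ is feasible. A descending greedy execution processes the rings in decreasing outer radius; when ring $i$ is processed, a container (the pan or the hole of an already placed ring) admits it if the container's current children together with ring $i$ are packable in it (sibling positions may be rearranged); the ring receives some admitting container as its permanent parent, chosen arbitrarily, and is skipped only if no container admits it. An execution fails if it does not place exactly $L$. $\rho=\max_i\bigl(\sum_{j>i}r_j\bigr)/r_i$. *)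

(* Defs.v *)
From mathcomp Require Import all_boot all_order all_algebra.
From mathcomp Require Import all_classical all_reals all_analysis.
Import Order.TTheory GRing.Theory Num.Theory.
Import numFieldNormedType.Exports.

Set Implicit Arguments.
Unset Strict Implicit.
Unset Printing Implicit Defensive.

Local Open Scope classical_set_scope.
Local Open Scope ring_scope.

(* MathComp world, with MathComp-Analysis. *)

(* The library norm on 'rV[R]_d is the sup norm, hence this explicit Euclidean
   norm; the two induce the same topology, so [interior] is the usual one. *)
Definition enorm (R : realType) (d : nat) (x : 'rV[R]_d) : R :=
  Num.sqrt (\sum_(k < d) x ord0 k ^+ 2).

Definition eball (R : realType) (d : nat) (c : 'rV[R]_d) (t : R) :
    set 'rV[R]_d :=
  [set x | enorm (x - c) <= t].

Record inventory (R : realType) (n : nat) := Inventory {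
  pan : R;
  outer : 'I_n -> R;
  hole : 'I_n -> R;
  pan_gt0 : 0 < pan;
  outer_gt0 : forall i, 0 < outer i;
  outer_decr : forall i j : 'I_n, (i < j)%N -> outer j < outer i;
  hole_ge0 : forall i, 0 <= hole i;
  hole_lt_outer : forall i, hole i < outer i
}.

(* For n = 0 the maximum is 0; for n > 0 all the ratios are nonnegative, so
   the default value 0 does not affect it. *)
Definition rho (R : realType) (n : nat) (I : inventory R n) : R :=
  \big[Num.max/0]_(i < n)
    ((\sum_(j < n | (i < j)%N) outer I j) / outer I i).

(* [None] is the pan, [Some j] is the hole of ring j. *)
Definition container (n : nat) : Type := option 'I_n.

Definition region (R : realType) (n : nat) (I : inventory R n)
    (k : container n) : R :=
  if k is Some j then hole I j else pan I.

(* The region is taken centred at the origin. *)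
Definition packable (R : realType) (d n : nat) (I : inventory R n)
    (C : {set 'I_n}) (t : R) : Prop :=
  exists c : 'I_n -> 'rV[R]_d,
    (forall i, i \in C -> eball (c i) (outer I i) `<=` eball 0 t) /\
    (forall i j, i \in C -> j \in C -> i != j ->
       (eball (c i) (outer I i))° `&` (eball (c j) (outer I j))° = set0).

(* [s i = None]: ring i is not placed; [s i = Some k]: its parent is k. *)
Definition assignment (n : nat) : Type := {ffun 'I_n -> option (option 'I_n)}.

Definition placed (n : nat) (s : assignment n) : {set 'I_n} :=
  [set i | s i != None]%SET.

Definition children (n : nat) (s : assignment n) (k : container n) :
    {set 'I_n} :=
  [set i | s i == Some k]%SET.

Definition available (n : nat) (s : assignment n) (k : container n) : bool :=
  if k is Some j then j \in placed s else true.

(* One step towards the root; the pan is its own ancestor. *)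
Definition up (n : nat) (s : assignment n) (k : container n) : container n :=
  if k is Some j then odflt None (s j) else None.

Definition is_placement (R : realType) (d n : nat) (I : inventory R n)
    (S : {set 'I_n}) (s : assignment n) : Prop :=
  [/\ placed s = S,
      forall i j, s i = Some (Some j) -> j \in S /\ outer I i <= hole I j,
      forall i, i \in S -> exists m, iter m (up s) (Some i) = None
    & forall k, available s k -> packable d I (children s k) (region I k)].

Definition feasible (R : realType) (d n : nat) (I : inventory R n)
    (S : {set 'I_n}) : Prop :=
  exists s, is_placement d I S s.

(* [enum 'I_n] is increasing, so the accumulator at ring i is the part of the
   lex-max set strictly below i. *)
Definition lexmax (R : realType) (d n : nat) (I : inventory R n) :
    {set 'I_n} :=
  foldl (fun L i => if `[< feasible d I (i |: L) >] then (i |: L)%SET else L)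
    finset.set0 (enum 'I_n).

Definition admits (R : realType) (d n : nat) (I : inventory R n)
    (s : assignment n) (k : container n) (i : 'I_n) : Prop :=
  available s k /\ packable d I (i |: children s k)%SET (region I k).

Definition place (n : nat) (s : assignment n) (i : 'I_n) (k : container n) :
    assignment n :=
  [ffun j => if j == i then Some k else s j].

Inductive greedy_run (R : realType) (d n : nat) (I : inventory R n) :
    seq 'I_n -> assignment n -> assignment n -> Prop :=
| GreedyDone s : greedy_run d I [::] s s
| GreedyPlace i k q s s' :
    admits d I s k i -> greedy_run d I q (place s i k) s' ->
    greedy_run d I (i :: q) s s'
| GreedySkip i q s s' :
    (forall k, ~ admits d I s k i) -> greedy_run d I q s s' ->
    greedy_run d I (i :: q) s s'.

Definition greedy_execution (R : realType) (d n : nat) (I : inventory R n)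
    (s : assignment n) : Prop :=
  greedy_run d I (enum 'I_n) [ffun=> None] s.

Definition greedy_can_fail (R : realType) (d n : nat) (I : inventory R n) :
    Prop :=
  exists s, greedy_execution d I s /\ placed s <> lexmax d I.

Definition failing_ratios (R : realType) (d : nat) (N : set nat) : set R :=
  [set x | exists (n : nat) (I : inventory R n),
     [/\ N n, greedy_can_fail d I & rho I = x]].

Arguments failing_ratios : clear implicits.

(* The infimum is taken in \bar R, so that it is +oo when nothing fails. *)
Definition tau (R : realType) (d : nat) (N : set nat) : \bar R :=
  ereal_inf (EFin @` failing_ratios R d N).

Definition golden (R : realType) : R := (1 + Num.sqrt 5) / 2.

Arguments tau : clear implicits.
Arguments golden : clear implicits.

(* Main.v *)
Require Import Defs.
From mathcomp Require Import all_boot all_order all_algebra.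
From mathcomp Require Import all_classical all_reals all_analysis.
From mathcomp Require Import ring lra zify.
Import Order.TTheory GRing.Theory Num.Theory.
Import numFieldNormedType.Exports.

(** Write [phi] for the golden ratio.

    Upper part. Consider the first ring at which a greedy execution and the
    lex-max scan disagree. Every ring that greedy places belongs to the lex-max
    set, because greedy maintains a placement; so at the disagreement greedy
    skips a ring [e] although the rings placed so far together with [e], at most
    five rings in all, have another placement. Compare the two forests, container
    by container. It is a contradiction if in some container the greedy children
    and [e] could be packed. This happens in two ways.
    - Domination: the children in the other forest are at least as many and, in
      order, at least as large ([fits_dominated]).
    - Crevices: if two siblings have radii [x >= y] the container has radius at
      least [x + y], and two balls of radius [z] fit beside [x] and [y] placed on
      a diameter, one on each side, provided
      [z (x^2 + x y + y^2) <= x y (x + y)] ([fits_crevice]). The bound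
      [rho <= phi] provides exactly this inequality when [2 z] is at most the sum
      of the radii of some rings below [y]: it gives [2 z <= phi y] and
      [y + 2 z <= phi x], and these imply it ([golden_crevice]). In particular it
      applies when [z] is the radius of a ring below that of radius [y] but not
      next to it.
    No packing of more than two balls has to be shown impossible here, and the
    packings that are built are planar, so all dimensions from two on behave
    alike. That these two ways cover every pair of
    forests on at most five rings is a finite verification on the codes of the
    forests ([all_refuted]), whose rules are proved sound in [not_refuted].

    Lower part. The crevice inequality is optimal in every dimension
    ([crevice_bound]), and the equality case of [golden_crevice] gives the limit
    radii [1, phi - 1, 1/2, 1/2] in a pan of radius [phi]. Enlarging the last two
    slightly gives failing instances with ratio as close to [phi] as desired, and
    none has ratio [phi] by the upper part. *)

Set Implicit Arguments.
Unset Strict Implicit.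
Unset Printing Implicit Defensive.

Local Open Scope classical_set_scope.
Local Open Scope ring_scope.

(** * Euclidean geometry of row vectors *)

Lemma continuous_translation (R : realType) (V : normedModType R) (c : V) :
  continuous (fun x : V => x - c).
Proof. by move=> x; apply: cvgB; [exact: cvg_id | exact: cvg_cst]. Qed.

Lemma cvg_line (R : realType) (V : normedModType R) (a u : V) :
  (fun e : R => a + e *: u) @ (0 : R) --> a.
Proof.
rewrite -[X in _ --> X]addr0 -[X in _ --> _ + X](scale0r u).
by apply: cvgD; [exact: cvg_cst | apply: cvgZr_tmp; exact: cvg_id].
Qed.

Section Euclid.
Variables (R : realType) (d : nat).
Implicit Types (u v w c x : 'rV[R]_d) (r s t : R).

Definition dot u v : R := \sum_(k < d) u ord0 k * v ord0 k.

Lemma dotC u v : dot u v = dot v u.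
Proof. by apply: eq_bigr => k _; rewrite mulrC. Qed.

Lemma dotDl u v w : dot (u + v) w = dot u w + dot v w.
Proof. by rewrite -big_split; apply: eq_bigr => k _; rewrite mxE mulrDl. Qed.

Lemma dotZl r u w : dot (r *: u) w = r * dot u w.
Proof. by rewrite mulr_sumr; apply: eq_bigr => k _; rewrite mxE mulrA. Qed.

Lemma dotNl u w : dot (- u) w = - dot u w.
Proof. by rewrite -scaleN1r dotZl mulN1r. Qed.

Lemma dotDr u v w : dot w (u + v) = dot w u + dot w v.
Proof. by rewrite !(dotC w) dotDl. Qed.

Lemma dotZr r u w : dot w (r *: u) = r * dot w u.
Proof. by rewrite !(dotC w) dotZl. Qed.

Lemma dotNr u w : dot w (- u) = - dot w u.
Proof. by rewrite !(dotC w) dotNl. Qed.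

Definition dotE := (dotDl, dotDr, dotZl, dotZr, dotNl, dotNr).

Lemma dot_ge0 u : 0 <= dot u u.
Proof. by apply: sumr_ge0 => k _; rewrite -expr2 sqr_ge0. Qed.

Lemma dot_eq0 u : dot u u = 0 -> u = 0.
Proof.
move=> /eqP; rewrite psumr_eq0 => [/allP u0|k _]; last by rewrite -expr2 sqr_ge0.
apply/rowP => k; rewrite mxE; apply/eqP.
by have := u0 k (mem_index_enum k); rewrite /= mulf_eq0 orbb.
Qed.

Lemma cauchy_schwarz u v : dot u v ^+ 2 <= dot u u * dot v v.
Proof.
have [v0|vN0] := eqVneq (dot v v) 0.
  by rewrite (dot_eq0 v0) -(scale0r 0) dotZr mul0r expr0n /= dotZr mul0r mulr0.
have vp : 0 < dot v v by rewrite lt_def vN0 dot_ge0.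
have := dot_ge0 (dot v v *: u - dot u v *: v).
rewrite !dotE (dotC v u) => h.
rewrite -subr_ge0 -(pmulr_rge0 _ vp); apply: le_trans h _.
by rewrite le_eqVlt; apply/orP; left; apply/eqP; ring.
Qed.

Lemma sqr_enorm u : enorm u ^+ 2 = dot u u.
Proof.
rewrite /enorm sqr_sqrtr; first by apply: eq_bigr => k _; rewrite expr2.
by apply: sumr_ge0 => k _; rewrite sqr_ge0.
Qed.

Lemma enorm_ge0 u : 0 <= enorm u.
Proof. exact: sqrtr_ge0. Qed.

Lemma enormZ r u : enorm (r *: u) = `|r| * enorm u.
Proof.
apply/eqP; rewrite -(@eqrXn2 _ 2) ?mulr_ge0 ?enorm_ge0 //.
by rewrite exprMn real_normK ?num_real // !sqr_enorm !dotE expr2 mulrA.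
Qed.

Lemma enormN u : enorm (- u) = enorm u.
Proof. by rewrite -scaleN1r enormZ normrN1 mul1r. Qed.

Lemma enorm0 : enorm (0 : 'rV[R]_d) = 0.
Proof. by rewrite -(scale0r 0) enormZ normr0 mul0r. Qed.

Lemma enormB u v : enorm (u - v) = enorm (v - u).
Proof. by rewrite -enormN opprB. Qed.

Lemma ler_enormD u v : enorm (u + v) <= enorm u + enorm v.
Proof.
rewrite -(@ler_pXn2r _ 2) ?nnegrE ?addr_ge0 ?enorm_ge0 //.
rewrite sqrrD !sqr_enorm !dotE (dotC v u).
suff : dot u v <= enorm u * enorm v by move=> ?; lra.
apply: le_trans (ler_norm _) _.
rewrite -(@ler_pXn2r _ 2) ?nnegrE ?mulr_ge0 ?enorm_ge0 //.
by rewrite real_normK ?num_real // exprMn !sqr_enorm cauchy_schwarz.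
Qed.

Lemma continuous_enorm : continuous (@enorm R d).
Proof.
have cs : continuous (fun u : 'rV[R]_d => \sum_(k < d) u ord0 k ^+ 2).
  apply: continuous_big => [|k _]; first exact: add_continuous.
  move=> u.
  apply: (@continuous_comp _ _ _ (fun u : 'rV[R]_d => u ord0 k) (fun a : R => a ^+ 2)).
    exact: coord_continuous.
  exact: exprn_continuous.
move=> u; apply: (continuous_comp (cs u)); exact: sqrt_continuous.
Qed.

Lemma open_ball_sub_interior c r :
  [set x | enorm (x - c) < r] `<=` (eball c r)°.
Proof.
have o : open [set x | enorm (x - c) < r].
  apply: (@open_comp _ _ (fun x => enorm (x - c)) [set a | a < r]); last exact: open_lt.
  move=> x _; apply: (@continuous_comp _ _ _ (fun x => x - c) (@enorm R d)).
    exact: continuous_translation.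
  exact: continuous_enorm.
by rewrite -(open_subsetE _ o) => x /= /ltW.
Qed.

(** A point of the interior can be pushed a little further away from the
    centre, so its distance to the centre is smaller than the radius. *)
Lemma interior_sub_open_ball c r : 0 < r ->
  (eball c r)° `<=` [set x | enorm (x - c) < r].
Proof.
move=> r0 x /= xin.
have /nbhs_ballP [e /= e0 he] :
    nbhs (0 : R) [set e | eball c r (x + e *: (x - c))].
  exact: (@cvg_line R 'rV[R]_d x (x - c) _ xin).
have := he (e / 2); rewrite /ball /= sub0r normrN gtr0_norm ?divr_gt0 //.
move=> /(_ (ltac:(lra))); rewrite /eball /=.
have -> : x + (e / 2) *: (x - c) - c = (1 + e / 2) *: (x - c).
  by rewrite scalerDl scale1r addrAC.
rewrite enormZ ger0_norm; last by lra.
by have := enorm_ge0 (x - c); nra.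
Qed.

(** The farthest point of the ball from the origin is on the ray through [c]; when
    [c = 0] every direction will do, and [0 < d] provides one. *)
Lemma eball_subset c r t : (0 < d)%N -> 0 < r ->
  eball c r `<=` eball 0 t <-> enorm c + r <= t.
Proof.
move=> d0 r0; split => [sub|le x]; last first.
  rewrite /eball /= subr0 => xc; have := ler_enormD (x - c) c.
  by rewrite subrK; lra.
have [c0|cN0] := eqVneq (enorm c) 0.
  pose e : 'rV[R]_d := delta_mx ord0 (Ordinal d0).
  have e1 : enorm e = 1.
    rewrite /enorm (bigD1 (Ordinal d0)) //= big1 => [|k /negbTE kN]; last first.
      by rewrite !mxE kN andbF expr0n.
    by rewrite !mxE !eqxx expr1n addr0 sqrtr1.
  have := sub (c + r *: e); rewrite /eball /= subr0 addrC addKr enormZ e1.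
  rewrite gtr0_norm // mulr1 lexx => /(_ isT) le.
  have := ler_enormD (c + r *: e) (- c).
  rewrite addrAC subrr add0r enormN enormZ e1 gtr0_norm //.
  by rewrite c0; lra.
have cp : 0 < enorm c by rewrite lt_def cN0 enorm_ge0.
have := sub (c + (r / enorm c) *: c); rewrite /eball /= subr0 addrC addKr.
rewrite enormZ gtr0_norm ?divr_gt0 // divfK // lexx => /(_ isT).
have -> : c + (r / enorm c) *: c = (1 + r / enorm c) *: c.
  by rewrite scalerDl scale1r.
by rewrite enormZ gtr0_norm ?addr_gt0 ?divr_gt0 // mulrDl divfK // mul1r.
Qed.

(** Centres closer than [r + r'] would leave in both interiors the point that
    divides the segment between them in the ratio of the radii. *)
Lemma interior_disjoint c c' r r' : 0 < r -> 0 < r' ->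
  (eball c r)° `&` (eball c' r')° = set0 <-> r + r' <= enorm (c - c').
Proof.
move=> r0 r'0; split => [dis|le]; last first.
  apply/seteqP; split => // x [/(interior_sub_open_ball r0) /= h].
  move=> /(interior_sub_open_ball r'0) /= h'.
  have := ler_enormD (c - x) (x - c'); rewrite addrA subrK (enormB c x).
  by lra.
rewrite leNgt; apply/negP => lt.
suff: (set0 : set 'rV[R]_d) (c + (r / (r + r')) *: (c' - c)) by [].
have rr : 0 < r + r' by lra.
rewrite -dis; split; apply: open_ball_sub_interior => /=.
  rewrite addrC addKr enormZ gtr0_norm ?divr_gt0 // enormB.
  by rewrite mulrAC ltr_pdivrMr // ltr_pM2l.
have -> : c + (r / (r + r')) *: (c' - c) - c' = (r' / (r + r')) *: (c - c').
  have -> : r' / (r + r') = 1 - r / (r + r') by field; lra.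
  by rewrite scalerBl scale1r -(opprB c c') scalerN -!addrA; congr (_ + _); rewrite addrC.
by rewrite enormZ gtr0_norm ?divr_gt0 // mulrAC ltr_pdivrMr // ltr_pM2l.
Qed.

End Euclid.

(** * Packing lists of balls into a ball *)

Lemma pairs4 (P : nat -> nat -> Prop) :
    P 0%N 1%N -> P 0%N 2%N -> P 0%N 3%N -> P 1%N 2%N -> P 1%N 3%N -> P 2%N 3%N ->
  forall i j, (i < j < 4)%N -> P i j.
Proof.
move=> h01 h02 h03 h12 h13 h23 i j.
by case: i => [|[|[|i]]]; case: j => [|[|[|[|j]]]] //; lia.
Qed.

Lemma pairs3 (P : nat -> nat -> Prop) : P 0%N 1%N -> P 0%N 2%N -> P 1%N 2%N ->
  forall i j, (i < j < 3)%N -> P i j.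
Proof.
by move=> h01 h02 h12 i j; case: i => [|[|i]]; case: j => [|[|[|j]]] //; lia.
Qed.

Section Fits.
Variables (R : realType) (d : nat).
Implicit Types (t x y z : R) (rs : seq R).

(** Metric form of packability. Lists of radii, rather than sets of rings, allow
    packings of different rings to be compared, and the same radius to be used
    twice. *)
Definition fits t rs : Prop :=
  exists c : nat -> 'rV[R]_d,
    (forall i, (i < size rs)%N -> enorm (c i) + rs`_i <= t) /\
    (forall i j, (i < j < size rs)%N -> rs`_i + rs`_j <= enorm (c i - c j)).

Lemma packable_fits n (I : inventory R n) (C : {set 'I_n}) (s : seq 'I_n) t :
    (0 < d)%N -> uniq s -> s =i C ->
  packable d I C t <-> fits t [seq outer I i | i <- s].
Proof.
move=> d0 us sC; have pos := outer_gt0 I; split => [[c [cin cdis]]|[c [cin cdis]]].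
  case: s us sC => [|x0 s] us sC.
    by exists (fun=> 0); split=> // i j; rewrite ltn0 andbF.
  set l := x0 :: s in us sC *; rewrite /fits size_map.
  have lC i : (i < size l)%N -> nth x0 l i \in C by move=> il; rewrite -sC mem_nth.
  exists (fun i => c (nth x0 l i)); split => [i il|i j /andP[ij jl]].
    by rewrite (nth_map x0) // -eball_subset //; apply: cin; exact: lC.
  have il := ltn_trans ij jl; rewrite !(nth_map x0) // -interior_disjoint //.
  by apply: cdis; rewrite ?lC // nth_uniq // ltn_eqF.
have idx i : i \in C -> (index i s < size s)%N by rewrite index_mem sC.
have val i : i \in C -> [seq outer I i | i <- s]`_(index i s) = outer I i.
  by move=> iC; rewrite (nth_map i) ?nth_index ?idx ?sC.
rewrite size_map in cin cdis.
exists (fun i => c (index i s)); split => [i iC|i j iC jC ij].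
  by apply/eball_subset => //; rewrite -(val i iC); exact/cin/idx.
have ne : index i s != index j s.
  by apply: contra ij => /eqP /index_inj -> //; rewrite sC.
case: (ltngtP (index i s) (index j s)) ne => // lt _.
  apply/interior_disjoint => //; rewrite -(val i iC) -(val j jC).
  by apply: cdis; rewrite lt idx.
rewrite setIC; apply/interior_disjoint => //.
by rewrite -(val i iC) -(val j jC); apply: cdis; rewrite lt idx.
Qed.

Lemma fits_dominated t rs rs' : (size rs' <= size rs)%N ->
  (forall i, (i < size rs')%N -> rs'`_i <= rs`_i) -> fits t rs -> fits t rs'.
Proof.
move=> sz le [c [cin cdis]]; exists c; split => [i is'|i j /andP[ij js']].
  by have := cin i (leq_trans is' sz); have := le i is'; lra.
have jl := leq_trans js' sz; have := cdis i j; rewrite ij jl => /(_ isT).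
by have := le i (ltn_trans ij js'); have := le j js'; lra.
Qed.

Lemma fits_enlarged t t' rs : t <= t' -> fits t rs -> fits t' rs.
Proof.
by move=> le [c [cin cdis]]; exists c; split => // i /cin h; exact: le_trans le.
Qed.

Lemma fits_mem t x rs : fits t rs -> x \in rs -> x <= t.
Proof.
move=> [c [cin _]] /(nthP 0) [i ir <-].
by have := cin i ir; have := enorm_ge0 (c i); lra.
Qed.

Lemma fits1 t x : x <= t -> fits t [:: x].
Proof.
move=> le; exists (fun=> 0); split => [[|//] _|i j /andP[ij]].
  by rewrite enorm0 add0r.
by rewrite ltnS leqNgt (leq_trans _ ij).
Qed.

(** The two centres are at distances at most [t - x] and [t - y] from the centre
    of the container, and at least [x + y] from each other. *)
Lemma fits_head2 t x y rs : fits t [:: x, y & rs] -> x + y <= t.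
Proof.
move=> [c [cin cdis]]; have /= h0 := cin 0%N isT; have /= h1 := cin 1%N isT.
have /= h01 := cdis 0%N 1%N isT.
by have := ler_enormD (c 0%N) (- c 1%N); rewrite enormN; lra.
Qed.

(** The packings below are planar; the plane of the first two coordinates is
    where the hypothesis on the dimension is used. *)
Definition plane x y : 'rV[R]_d :=
  \row_k (if k == 0%N :> nat then x else if k == 1%N :> nat then y else 0).

Lemma planeB x y x' y' : plane x y - plane x' y' = plane (x - x') (y - y').
Proof.
apply/rowP => k; rewrite !mxE.
by case: ifP => // _; case: ifP => // _; rewrite subr0.
Qed.

Hypothesis d2 : (2 <= d)%N.

Lemma enorm_plane x y : enorm (plane x y) ^+ 2 = x ^+ 2 + y ^+ 2.
Proof.
rewrite sqr_enorm /dot; have d0 : (0 < d)%N by exact: leq_trans d2.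
rewrite (bigD1 (Ordinal d0)) //= (bigD1 (Ordinal d2)) //= big1 => [|k].
  by rewrite !mxE /= addr0 !expr2.
rewrite -!val_eqE /= mxE => /andP[/negbTE -> /negbTE ->].
by rewrite mul0r.
Qed.

Lemma enorm_plane_le x y t : 0 <= t -> x ^+ 2 + y ^+ 2 <= t ^+ 2 ->
  enorm (plane x y) <= t.
Proof.
by move=> t0; rewrite -enorm_plane ler_pXn2r ?nnegrE ?enorm_ge0.
Qed.

Lemma enorm_plane_ge x y t : 0 <= t -> t ^+ 2 <= x ^+ 2 + y ^+ 2 ->
  t <= enorm (plane x y).
Proof.
by move=> t0; rewrite -enorm_plane ler_pXn2r ?nnegrE ?enorm_ge0.
Qed.

(** Both balls are put on a diameter. *)
Lemma fits2 t x y : 0 <= x -> 0 <= y -> x + y <= t -> fits t [:: x; y].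
Proof.
move=> x0 y0; move/fits_enlarged; apply.
exists (fun i => if i is 0%N then plane (- y) 0 else plane x 0).
split => [[|[|//]] _ /=|i j ij].
- have : enorm (plane (- y) 0) <= y by apply: enorm_plane_le; lra.
  by lra.
- have : enorm (plane x 0) <= x by apply: enorm_plane_le; lra.
  by lra.
- have [-> ->] /= : i = 0%N /\ j = 1%N by move: ij => /=; lia.
  by rewrite planeB; apply: enorm_plane_ge; lra.
Qed.

(** Let balls of radii [x] and [y] fill a diameter of a ball of radius [x + y].
    By Descartes' circle theorem a ball touching all three has radius
    [x y (x + y) / (x^2 + x y + y^2)]. This is the first circle of a Pappus chain,
    so its centre is at distance twice its radius from the diameter, and its
    mirror image is disjoint from it. Hence the crevice on each side of the
    diameter receives a ball of that radius, or any smaller one. *)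
Lemma fits_crevice x y z : 0 < x -> 0 < y ->
    z * (x ^+ 2 + x * y + y ^+ 2) <= x * y * (x + y) ->
  fits (x + y) [:: x; y; z; z].
Proof.
move=> x0 y0 hz; pose N := x ^+ 2 + x * y + y ^+ 2.
have N0 : 0 < N by rewrite /N; nra.
pose Z := x * y * (x + y) / N; have zZ : z <= Z by rewrite ler_pdivlMr.
have Z0 : 0 < Z by rewrite /Z divr_gt0 // !mulr_gt0 // addr_gt0.
(* [X] is the coordinate, along the diameter, of the centre of the touching
   ball; the origin is the centre of the container. *)
pose X := (x - y) * (x + y) ^+ 2 / N.
have eX : x + Z = x * (x ^+ 2 + 2 * x * y + 2 * y ^+ 2) / N.
  by rewrite /Z /N; field; rewrite -/N; lra.
have eY : y + Z = y * (2 * x ^+ 2 + 2 * x * y + y ^+ 2) / N.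
  by rewrite /Z /N; field; rewrite -/N; lra.
have eD : x + y - Z = (x + y) * (x ^+ 2 + y ^+ 2) / N.
  by rewrite /Z /N; field; rewrite -/N; lra.
have dX : (X + y) ^+ 2 + (2 * Z) ^+ 2 = (x + Z) ^+ 2.
  by rewrite eX /X /Z /N; field; rewrite -/N; lra.
have dY : (X - x) ^+ 2 + (2 * Z) ^+ 2 = (y + Z) ^+ 2.
  by rewrite eY /X /Z /N; field; rewrite -/N; lra.
have dD : X ^+ 2 + (2 * Z) ^+ 2 = (x + y - Z) ^+ 2.
  by rewrite eD /X /Z /N; field; rewrite -/N; lra.
have D0 : 0 <= x + y - Z.
  by rewrite eD; apply/ltW/divr_gt0 => //; rewrite mulr_gt0 ?addr_gt0 ?exprn_gt0.
clear hz eX eY eD; clearbody Z X; clear N N0.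
apply: (@fits_dominated _ [:: x; y; Z; Z]) => [//|[|[|[|[|//]]]] _ //=|].
exists (fun i => nth 0 [:: plane (- y) 0; plane x 0; plane X (2 * Z);
                           plane X (- (2 * Z))] i).
have bD : enorm (plane X (2 * Z)) <= x + y - Z by apply: enorm_plane_le; lra.
have bD' : enorm (plane X (- (2 * Z))) <= x + y - Z.
  by apply: enorm_plane_le => //; rewrite sqrrN; lra.
split => [[|[|[|[|//]]]] _ /=|].
- have : enorm (plane (- y) 0) <= y by apply: enorm_plane_le; lra.
  by lra.
- have : enorm (plane x 0) <= x by apply: enorm_plane_le; lra.
  by lra.
- by lra.
- by lra.
have ge (u v a b t : R) : 0 < t -> (u - a) ^+ 2 + (v - b) ^+ 2 >= t ^+ 2 ->
    t <= enorm (plane u v - plane a b).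
  by move=> t0 h; rewrite planeB; apply: enorm_plane_ge => //; exact: ltW.
have Z2 := sqr_ge0 Z.
by apply: pairs4 => /=; apply: ge; lra.
Qed.

(** The previous bound is optimal, in every dimension: in a ball of radius
    [x + y] the balls of radii [x] and [y] have opposite centres [u] and [v], with
    [x u + y v = 0], and Stewart's identity then bounds a third radius. *)
Lemma crevice_bound x y z rs : 0 < x -> 0 < y -> 0 < z ->
    fits (x + y) [:: x, y, z & rs] ->
  z * (x ^+ 2 + x * y + y ^+ 2) <= x * y * (x + y).
Proof.
move=> x0 y0 z0 [c [cin cdis]].
have /= a0 := cin 0%N isT; have /= a1 := cin 1%N isT; have /= a2 := cin 2%N isT.
have /= b01 := cdis 0%N 1%N isT; have /= b02 := cdis 0%N 2%N isT.
have /= b12 := cdis 1%N 2%N isT.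
move: (c 0%N) (c 1%N) (c 2%N) a0 a1 a2 b01 b02 b12 => u v w a0 a1 a2 b01 b02 b12.
have sq (p q : R) : 0 <= p -> p <= q -> p ^+ 2 <= q ^+ 2.
  by move=> p0 pq; rewrite ler_pXn2r ?nnegrE //; lra.
have {}a0 : dot u u <= y ^+ 2 by rewrite -sqr_enorm sq ?enorm_ge0 //; lra.
have {}a1 : dot v v <= x ^+ 2 by rewrite -sqr_enorm sq ?enorm_ge0 //; lra.
have {}a2 : dot w w <= (x + y - z) ^+ 2.
  by rewrite -sqr_enorm sq ?enorm_ge0 //; lra.
have {}b01 : (x + y) ^+ 2 <= dot (u - v) (u - v) by rewrite -sqr_enorm sq //; lra.
have {}b02 : (x + z) ^+ 2 <= dot (u - w) (u - w) by rewrite -sqr_enorm sq //; lra.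
have {}b12 : (y + z) ^+ 2 <= dot (v - w) (v - w) by rewrite -sqr_enorm sq //; lra.
have bal : x *: u + y *: v = 0.
  apply: dot_eq0; apply/eqP; rewrite eq_le dot_ge0 andbT.
  have := ler_wpM2l (mulr_ge0 (ltW x0) (ltW y0)) b01.
  have := ler_wpM2l (mulr_ge0 (ltW x0) (ltW (addr_gt0 x0 y0))) a0.
  have := ler_wpM2l (mulr_ge0 (ltW y0) (ltW (addr_gt0 x0 y0))) a1.
  by rewrite !dotE (dotC v u); lra.
have bw : x * dot u w + y * dot v w = 0.
  by rewrite -!dotZl -dotDl bal -(scale0r 0) dotZl mul0r.
move: b02 b12; rewrite !dotE (dotC w u) (dotC w v) => b02 b12.
have xb : x * (x + z) ^+ 2 <= x * (dot u u + - dot u w + (- dot u w + - - dot w w)).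
  by rewrite ler_pM2l.
have yb : y * (y + z) ^+ 2 <= y * (dot v v + - dot v w + (- dot v w + - - dot w w)).
  by rewrite ler_pM2l.
have xa : x * dot u u <= x * y ^+ 2 by rewrite ler_pM2l.
have ya : y * dot v v <= y * x ^+ 2 by rewrite ler_pM2l.
have wa : (x + y) * dot w w <= (x + y) * (x + y - z) ^+ 2 by rewrite ler_pM2l ?addr_gt0.
by lra.
Qed.

End Fits.

(** * The golden ratio *)

Section Golden.
Variable R : realType.
Local Notation phi := (golden R).

Lemma golden_sqr : phi ^+ 2 = phi + 1.
Proof.
have s5 : Num.sqrt (5 : R) ^+ 2 = 5 by rewrite sqr_sqrtr.
by rewrite /golden; lra.
Qed.

Lemma golden_bounds : 8 / 5 < phi < 13 / 8.
Proof.
have s5 : Num.sqrt (5 : R) ^+ 2 = 5 by rewrite sqr_sqrtr.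
have s0 : 0 <= Num.sqrt (5 : R) by exact: sqrtr_ge0.
by rewrite /golden; apply/andP; split; nra.
Qed.

(** Where the golden ratio comes from. If [phi y <= x] the first hypothesis gives
    the conclusion, otherwise the second one does; the two hypotheses meet at
    [x = phi y], [z = phi y / 2], where the conclusion is an equality. Once [z]
    is replaced by its bound, the difference of the two sides is [x - phi y], up to
    sign, times a polynomial with positive coefficients. *)
Lemma golden_crevice (x y z : R) : 0 < x -> 0 < y ->
    z + z <= phi * y -> y + (z + z) <= phi * x ->
  z * (x ^+ 2 + x * y + y ^+ 2) <= x * y * (x + y).
Proof.
move=> x0 y0 zy zx; have /andP[lo hi] := golden_bounds.
have phi2 := golden_sqr.
have N0 : 0 <= x ^+ 2 + x * y + y ^+ 2 by nra.
case: (lerP (phi * y) x) => xy.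
  have := ler_wpM2r N0 zy.
  have : 0 <= (x - phi * y) * ((2 - phi) * x + y) by apply: mulr_ge0; nra.
  have -> : (x - phi * y) * ((2 - phi) * x + y)
     = (2 - phi) * x ^+ 2 + (1 - phi * 2 + phi ^+ 2) * (x * y) - phi * y ^+ 2 by ring.
  rewrite phi2.
  have -> : 1 - phi * 2 + (phi + 1) = 2 - phi by ring.
  move=> h1 h2.
  have {}h1 := ler_wpM2r (ltW y0) h1.
  by lra.
have := ler_wpM2r N0 zx.
have : 0 <= (phi * y - x) * (phi * x ^+ 2 + (2 * phi - 2) * (x * y) + (phi - 1) * y ^+ 2).
  apply: mulr_ge0; first lra.
  by rewrite !addr_ge0 // mulr_ge0 ?sqr_ge0 ?mulr_ge0 ?ltW //; lra.
have -> : (phi * y - x) * (phi * x ^+ 2 + (2 * phi - 2) * (x * y) + (phi - 1) * y ^+ 2)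
   = - phi * x ^+ 3 + (phi ^+ 2 - 2 * phi + 2) * (x ^+ 2 * y)
     + (2 * phi ^+ 2 - 3 * phi + 1) * (x * y ^+ 2) + (phi ^+ 2 - phi) * y ^+ 3 by ring.
rewrite phi2.
by lra.
Qed.

End Golden.

(** * The finite case analysis *)

(** Rings are numbered [0, 1, ...] by decreasing radius. A forest is the list of
    the parents of the rings, where [0] codes the pan and [p.+1] the ring [p].
    A parent is larger than its child, so the code of the parent of [p] is at
    most [p]. *)
Fixpoint forests (m : nat) : seq (seq nat) :=
  if m is m'.+1 then [seq rcons f k | f <- forests m', k <- iota 0 m] else [:: [::]].

Lemma mem_forests (f : nat -> nat) m :
  (forall p, (p < m)%N -> (f p <= p)%N) -> mkseq f m \in forests m.
Proof.
elim: m => [|m IH] le //; rewrite mkseqS; apply/allpairsP.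
exists (mkseq f m, f m) => /=; split => //.
  by apply: IH => p pm; apply: le; exact: ltn_trans pm _.
by rewrite -[0%N :: iota 1 m]/(iota 0 m.+1) mem_iota add0n ltnS le.
Qed.

Definition kids (f : seq nat) (k : nat) : seq nat :=
  [seq p <- iota 0 (size f) | nth 0%N f p == k].

(** Lists of rings are increasing, hence their radii are decreasing: where the
    rings of [C] fit, so do those of a list [D] that [C] dominates. *)
Definition dominates (C D : seq nat) : bool :=
  (size D <= size C)%N && all (fun i => nth 0%N C i <= nth 0%N D i)%N (iota 0 (size D)).

(** In the forest [g] the container [k] has a single child [w], and ring [e], the
    last one, does not fit beside it, so [t k < r w + r e] for its radius [t k].
    In the forest [o] the same container holds a ring [v <= z], so
    [r z <= r v <= t k]. Hence [r z < r w + r e], with [z < w]. *)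
Definition squeezed (g o : seq nat) (z : nat) : bool :=
  has (fun k => (size (kids g k) == 1%N) && (z < head 0%N (kids g k))%N
                && has (fun v => v <= z)%N (kids o k)) (iota 0 (size o)).

(** If [x] and [y] are siblings, their container has radius at least [r x + r y],
    so two balls of radius [r z] fit beside them as soon as [golden_crevice]
    applies, that is, as soon as [2 r z] is at most the sum of the radii of
    distinct rings smaller than [y]. Such rings are [y.+1] and [z] when
    [y.+1 < z], and [z], [w], [e] when [z] is squeezed by [w] and [e]. *)
Definition crevice_fits (g o : seq nat) (C D : seq nat) : bool :=
  if C is [:: x, y & _] then
    has (fun z => ((y.+1 < z) || (y < z) && squeezed g o z)%N
                  && dominates [:: x; y; z; z] D)
        (iota 0 (size o))
  else false.

(** [g] is the greedy forest on the rings before [e] and [o] an arbitrary forest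
    that also places [e]. They cannot coexist if some container [k] has room for
    its greedy children together with [e], contrary to the skipping of [e]. *)
Definition refuted (g o : seq nat) : bool :=
  has (fun k => let D := rcons (kids g k) (size g) in
       [|| dominates (kids o k) D, crevice_fits g o (kids g k) D
         | crevice_fits g o (kids o k) D]) (iota 0 (size o)).

(** [e] counts the rings placed before the skipped one, hence [e < 5]. *)
Lemma all_refuted :
  all (fun e => all (fun g => all (refuted g) (forests e.+1)) (forests e)) (iota 0 5).
Proof. by vm_compute. Qed.

Section Refutation.
Variables (R : realType) (d e : nat) (r t : nat -> R) (g o : seq nat).
Hypotheses (d2 : (2 <= d)%N) (r_gt0 : forall p, 0 < r p).
Hypothesis r_decr : forall p q, (p < q <= e)%N -> r q < r p.
Hypothesis r_golden : forall p s, uniq s -> all (fun q => p < q <= e)%N s ->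
  \sum_(q <- s) r q <= golden R * r p.
Hypotheses (sg : size g = e) (so : size o = e.+1).
Hypothesis g_fits : forall k, (k <= e)%N -> fits d (t k) [seq r p | p <- kids g k].
Hypothesis g_full : forall k, (k <= e)%N ->
  ~ fits d (t k) [seq r p | p <- rcons (kids g k) e].
Hypothesis o_fits : forall k, (k <= e)%N -> fits d (t k) [seq r p | p <- kids o k].

Lemma dominates_fits u (C D : seq nat) : all (fun p => p <= e)%N D ->
  dominates C D -> fits d u [seq r p | p <- C] -> fits d u [seq r p | p <- D].
Proof.
move=> De /andP[sz /allP CD]; apply: fits_dominated; rewrite ?size_map // => i iD.
rewrite !(nth_map 0%N) //; last exact: leq_trans sz.
have := CD i; rewrite mem_iota add0n => /(_ iD).
rewrite leq_eqVlt => /orP[/eqP -> //|lt].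
by apply/ltW/r_decr; rewrite lt (allP De) // mem_nth.
Qed.

Lemma kids_lt f k p : p \in kids f k -> (p < size f)%N.
Proof. by rewrite mem_filter mem_iota => /andP[]. Qed.

Lemma squeezed_lt z : squeezed g o z ->
  exists w, [/\ (z < w < e)%N & r z < r w + r e].
Proof.
move=> /hasP[k]; rewrite mem_iota leq0n so add0n ltnS andTb => ke.
case E : (kids g k) => [|w [|//]] //= /andP[zw /hasP[v vo vz]]; exists w.
have we : (w < e)%N by rewrite -sg; apply: (@kids_lt _ k); rewrite E mem_head.
split; first by rewrite zw.
have := g_full ke; rewrite E /= => nfit.
have tk : t k < r w + r e.
  by rewrite ltNge; apply/negP => le; apply: nfit; apply: fits2 => //; exact: ltW.
apply: le_lt_trans tk; apply: (@le_trans _ _ (r v)); last first.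
  exact: fits_mem (o_fits ke) (map_f _ vo).
move: vz; rewrite leq_eqVlt => /orP[/eqP -> //|vz].
by apply/ltW/r_decr; rewrite vz ltnW // (ltn_trans zw).
Qed.

(** The list [s] below collects the rings smaller than [y] whose radii add up to
    at least [2 r z]; [r_golden], for [y] and then for [x], turns it into the two
    hypotheses of [golden_crevice]. *)
Lemma crevice_fits_sound k C :
    (k <= e)%N -> (forall p, p \in C -> p <= e)%N -> sorted ltn C ->
  fits d (t k) [seq r p | p <- C] -> ~~ crevice_fits g o C (rcons (kids g k) e).
Proof.
move=> ke; case: C => [|x [|y C]] //= Ce /andP[xy _] /fits_head2 xyt.
apply/negP => /hasP[z]; rewrite mem_iota leq0n so add0n ltnS andTb => ze /andP[cond dom].
apply: (g_full ke); apply: dominates_fits dom _.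
  rewrite all_rcons leqnn; apply/allP => p /kids_lt; rewrite sg; exact: ltnW.
apply: fits_enlarged xyt _; apply: fits_crevice => //.
suff [s [us sy zs]] : exists s, [/\ uniq s, all (fun q => y < q <= e)%N s
    & r z + r z <= \sum_(q <- s) r q].
  apply: golden_crevice => //; first exact: le_trans zs (r_golden us sy).
  have := @r_golden x (y :: s); rewrite /= us big_cons andbT.
  have ys : y \notin s by apply/negP => /(allP sy); rewrite ltnn.
  have ye : (y <= e)%N by apply: Ce; rewrite !inE eqxx orbT.
  rewrite ys xy ye => /(_ isT) h.
  apply: le_trans (h _); first by rewrite lerD2l.
  by apply: sub_all sy => q /andP[yq ->]; rewrite (ltn_trans xy).
case/orP: cond => [yz|/andP[yz /squeezed_lt [w [/andP[zw we] lt]]]].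
  exists [:: y.+1; z]; split.
  - by rewrite /= inE andbT ltn_eqF.
  - by rewrite /= ltnSn ze (ltnW yz) (leq_trans _ ze) // ltnW.
  - by rewrite !big_cons big_nil addr0 lerD2r ltW // r_decr // yz.
exists [:: z; w; e]; split.
- by rewrite /= !inE andbT negb_or !ltn_eqF // (ltn_trans zw).
- by rewrite /= yz ze (ltn_trans yz zw) (ltnW we) leqnn andbT (leq_trans yz).
- by rewrite !big_cons big_nil addr0 lerD2l ltW.
Qed.

(** Soundness of the rules: [r] gives the radii of the rings and [t] those of the
    containers, and a refutation exhibits a packing that [g_full] excludes. *)
Lemma not_refuted : ~~ refuted g o.
Proof.
apply/negP => /hasP[k]; rewrite mem_iota leq0n so add0n ltnS andTb sg => ke.
have ge p : p \in kids g k -> (p <= e)%N by move/kids_lt; rewrite sg; exact: ltnW.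
have oe p : p \in kids o k -> (p <= e)%N by move/kids_lt; rewrite so.
have srt f : sorted ltn (kids f k).
  by apply: sorted_filter; [exact: ltn_trans | exact: iota_ltn_sorted].
case/or3P; last 2 first.
- by apply/negP/crevice_fits_sound => //; exact: g_fits.
- by apply/negP/crevice_fits_sound => //; exact: o_fits.
move=> dom; apply: (g_full ke); apply: dominates_fits dom (o_fits ke).
by rewrite all_rcons leqnn; exact/allP.
Qed.

End Refutation.

(** * Greedy runs and the lex-max set *)

Section Greedy.
Variables (R : realType) (d n : nat) (I : inventory R n).
Implicit Types (s o : assignment n) (i j : 'I_n) (k : container n).

(** Only some of the rings below [x] may be placed; their total radius is still
    controlled by [rho]. *)
Lemma tail_sum_le_rho (x : 'I_n) (l : seq 'I_n) :
  uniq l -> all (fun j : 'I_n => x < j)%N l ->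
  \sum_(j <- l) outer I j <= rho I * outer I x.
Proof.
move=> ul /allP xl; have pos j := outer_gt0 I j.
apply: (@le_trans _ _ (\sum_(j < n | (x < j)%N) outer I j)); last first.
  rewrite -ler_pdivrMr //.
  exact: (le_bigmax _ (fun i : 'I_n => (\sum_(j < n | (i < j)%N) outer I j) / outer I i)).
rewrite big_uniq //= [leRHS](bigID [in l]) /=.
rewrite [X in _ <= X + _](eq_bigl [in l]) => [|j]; last first.
  by rewrite andb_idl // => /xl.
by rewrite lerDl; apply: sumr_ge0 => j _; exact: ltW.
Qed.

Lemma parent_lt (S : {set 'I_n}) s i j : is_placement d I S s ->
  s i = Some (Some j) -> j \in S /\ (j < i)%N.
Proof.
case=> _ par _ _ /par [jS hole]; split => //; rewrite ltnNge; apply/negP.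
rewrite leq_eqVlt => /orP[/eqP/val_inj ij|/(outer_decr I) lt].
  by move: hole; rewrite ij leNgt hole_lt_outer.
by have := hole_lt_outer I j; lra.
Qed.

(** Parents have smaller indices, so climbing towards the root terminates. *)
Lemma reaches_pan s : (forall i j, s i = Some (Some j) -> (j < i)%N) ->
  forall i, exists m, iter m (up s) (Some i) = None.
Proof.
move=> par i; have [m] := ubnP (i : nat); elim: m i => // m IH i.
rewrite ltnS => im; case E : (s i) => [[j|]|]; try by exists 1%N; rewrite /= E.
have [m' h] := IH j (leq_trans (par _ _ E) im).
by exists m'.+1; rewrite iterSr /= E.
Qed.

Hypothesis d2 : (2 <= d)%N.
Let d0 : (0 < d)%N := ltnW d2.

Lemma placed_place s i k : placed (place s i k) = (i |: placed s)%SET.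
Proof. by apply/setP => j; rewrite !inE ffunE; case: (j == i). Qed.

Lemma admits_placement s k i :
    is_placement d I (placed s) s -> (forall j, j \in placed s -> (j < i)%N) ->
  admits d I s k i -> is_placement d I (i |: placed s)%SET (place s i k).
Proof.
move=> pl lt [av pk]; have [_ par _ pks] := pl.
have iN : i \notin placed s by apply/negP => /lt; rewrite ltnn.
have par' j j' : place s i k j = Some (Some j') ->
    (j' < j)%N /\ (j' \in (i |: placed s)%SET /\ outer I j <= hole I j').
  rewrite ffunE; case: eqP => [-> [kj']|_ sj].
    move: av pk; rewrite kj' /= => av pk; split; first exact: lt.
    split; first by rewrite inE av orbT.
    have /(packable_fits I (hole I j') d0 (enum_uniq _) (mem_enum _)) f := pk.
    by apply: (fits_mem f); apply: map_f; rewrite mem_enum !inE eqxx.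
  have [_ j'j] := parent_lt pl sj; have [j's le] := par _ _ sj.
  by split=> //; split => //; rewrite inE j's orbT.
split.
- exact: placed_place.
- by move=> j j' /par' [].
- by move=> j _; apply: reaches_pan => a b /par' [].
move=> k' av'.
have [->|kk'] := eqVneq k' k.
  have -> // : children (place s i k) k = (i |: children s k)%SET.
  by apply/setP => j; rewrite !inE ffunE; case: (j == i); rewrite ?eqxx.
have -> : children (place s i k) k' = children s k'.
  apply/setP => j; rewrite !inE ffunE; case: (eqVneq j i) => [->|//].
  rewrite (inj_eq Some_inj) eq_sym (negbTE kk').
  by move: iN; rewrite inE negbK => /eqP ->.
case E : k' av' => [j|]; last by move=> _; exact: pks.
rewrite /= placed_place !inE => /orP[/eqP ji|jp]; last by apply: pks; rewrite /= inE.
have -> : children s (Some j) = finset.set0.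
  apply/setP => a; rewrite !inE; apply/negP => /eqP /(parent_lt pl) [].
  by rewrite ji (negbTE iN).
apply/(packable_fits I _ d0 (s := [::])) => //.
  by move=> a; rewrite !inE.
by exists (fun=> 0); split=> // a b; rewrite ltn0 andbF.
Qed.

Section Coding.
Variables (l : seq 'I_n) (i : 'I_n).
Hypotheses (ul : uniq (rcons l i)).

Let e := size l.
Let x p := nth i l p.

(** [l] lists placed rings by decreasing radius and [i] is the next ring; a ring
    is coded by its position in [rcons l i]. The default value of [nth] makes
    position [size l] denote [i]. *)
Definition code (c : option (container n)) : nat :=
  if c is Some (Some j) then (index j l).+1 else 0%N.

Definition decode (k : nat) : container n :=
  if k is p.+1 then Some (x p) else None.

Definition coded_parents (f : assignment n) m := mkseq (fun p => code (f (x p))) m.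

Lemma uniq_rings m : (m <= e.+1)%N -> uniq [seq x p | p <- iota 0 m].
Proof.
move=> me; rewrite map_inj_in_uniq ?iota_uniq // => p q.
rewrite !mem_iota !add0n /= => pm qm.
have nx a : (a < m)%N -> x a = nth i (rcons l i) a.
  by move=> am; rewrite nth_rcons_default.
rewrite !nx // => /eqP; rewrite nth_uniq ?size_rcons ?(leq_trans _ me) //.
by move/eqP.
Qed.

Lemma kids_children (f : assignment n) (m k : nat) : (k <= e)%N -> (m <= e.+1)%N ->
    placed f =i [seq x p | p <- iota 0 m] ->
    (forall j j', f j = Some (Some j') -> j' \in l) ->
  let K := [seq x p | p <- kids (coded_parents f m) k] in
  uniq K /\ K =i children f (decode k).
Proof.
move=> ke me pf par K.
have EK : kids (coded_parents f m) k = [seq p <- iota 0 m | code (f (x p)) == k].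
  rewrite /kids size_mkseq; apply: eq_in_filter => p; rewrite mem_iota add0n => /= pm.
  by rewrite nth_mkseq.
have ul' : uniq l by move: ul; rewrite rcons_uniq => /andP[].
split.
  by apply: subseq_uniq (uniq_rings me); rewrite /K EK; apply/map_subseq/filter_subseq.
move=> j; rewrite inE; apply/mapP/eqP => [[p]|fj].
  rewrite EK mem_filter => /andP[/eqP cp pm ->].
  have : x p \in placed f by rewrite pf map_f.
  rewrite inE; case E : (f (x p)) cp => [[j'|]|] //= <- _ //.
  by rewrite /= /x nth_index // (par _ _ E).
have : j \in placed f by rewrite inE fj.
rewrite pf => /mapP[p pm jp]; exists p => //; rewrite EK mem_filter pm andbT -jp fj.
case: k ke fj {EK K} => [|k] //= ke _.
by rewrite index_uniq.
Qed.

End Coding.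

Hypotheses (n5 : (n <= 5)%N) (rho_golden : rho I <= golden R).

(** If the rings placed so far together with [i] have any placement at all, the
    greedy placement admits [i]; otherwise the two placements would give a pair
    of forests that none of the rules refutes. *)
Lemma greedy_admits s o i :
    is_placement d I (placed s) s -> (forall j, j \in placed s -> (j < i)%N) ->
    is_placement d I (i |: placed s)%SET o ->
  exists k, admits d I s k i.
Proof.
move=> pls lti plo; apply: contrapT => /forallNP nadm.
set l := enum (placed s); set e := size l.
have il : i \notin l by rewrite mem_enum; apply/negP => /lti; rewrite ltnn.
have ul : uniq (rcons l i) by rewrite rcons_uniq il enum_uniq.
pose x p := nth i l p; pose r p := outer I (x p).
pose t (k : nat) := region I (decode l i k).
have xe : x e = i by rewrite /x nth_default.
have xl p : (p < e)%N -> x p \in l by move=> pe; rewrite mem_nth.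
have srt : sorted (fun a b : 'I_n => a < b)%N l.
  rewrite /l /enum_mem; apply: sorted_filter; first by move=> a b c; exact: ltn_trans.
  by rewrite -(@sorted_map _ _ val ltn) -enumT val_enum_ord iota_ltn_sorted.
have x_lt p q : (p < q <= e)%N -> (x p < x q)%N.
  move=> /andP[pq]; rewrite leq_eqVlt => /orP[/eqP qe|qe].
    by rewrite qe xe lti // -mem_enum xl // -qe.
  apply: (sorted_ltn_nth _ i srt) => //; first by move=> a b c; exact: ltn_trans.
  by rewrite inE; exact: ltn_trans qe.
have e5 : (e < 5)%N.
  apply: leq_trans n5; rewrite -[leqRHS]card_ord -(size_rcons l i).
  by rewrite -(card_uniqP ul) max_card.
have code_le f p S : (p <= e)%N -> is_placement d I S f ->
    (forall j, j \in S -> (j < x p)%N -> j \in l) -> (code l (f (x p)) <= p)%N.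
  move=> pe pl Sl; case E : (f (x p)) => [[j|]|] //=.
  have [jS jp] := parent_lt pl E; have jl := Sl _ jS jp.
  rewrite ltnNge leq_eqVlt; apply/negP => pj.
  suff : (x p <= j)%N by rewrite leqNgt jp.
  rewrite -(nth_index i jl) -/(x _); case/orP: pj => [/eqP <- //|pj].
  by apply/ltnW/x_lt; rewrite pj ltnW // index_mem.
pose g := coded_parents l i s e; pose o' := coded_parents l i o e.+1.
have gf : g \in forests e.
  apply: mem_forests => p pe; apply: code_le pls _; first exact: ltnW.
  by move=> j; rewrite mem_enum.
have of' : o' \in forests e.+1.
  apply: mem_forests => p; rewrite ltnS => pe; apply: code_le plo _ => // j.
  rewrite !inE mem_enum inE => /orP[/eqP -> ip|//].
  move: pe; rewrite leq_eqVlt => /orP[/eqP pe|pe].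
    by move: ip; rewrite pe xe ltnn.
  by have := lti (x p); rewrite -mem_enum xl // => /(_ isT) /(ltn_trans ip); rewrite ltnn.
have par_s j j' : s j = Some (Some j') -> j' \in l.
  by move=> /(parent_lt pls) []; rewrite mem_enum.
have par_o j j' : o j = Some (Some j') -> j' \in l.
  move=> oj; have [jS jj'] := parent_lt plo oj.
  have jp : j \in (i |: placed s)%SET by case: plo => <- _ _ _; rewrite inE oj.
  move: jS; rewrite mem_enum in_setU1 => /orP[/eqP j'i|//].
  move: jp; rewrite in_setU1 => /orP[/eqP ji|/lti ji].
    by move: jj'; rewrite j'i ji ltnn.
  by have := ltn_trans jj' ji; rewrite j'i ltnn.
have rings_s : placed s =i [seq x p | p <- iota 0 e].
  by move=> j; rewrite -/(mkseq x e) mkseq_nth mem_enum.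
have rings_o : placed o =i [seq x p | p <- iota 0 e.+1].
  move=> j; rewrite -/(mkseq x e.+1) mkseqS mkseq_nth mem_rcons xe inE mem_enum.
  by case: plo => -> _ _ _; rewrite in_setU1.
have av (k : nat) : (k <= e)%N -> available s (decode l i k).
  by case: k => // p pe; rewrite /= -mem_enum xl.
have kid_s (k : nat) (ke : (k <= e)%N) := kids_children ul ke (leqnSn e) rings_s par_s.
have kid_o (k : nat) (ke : (k <= e)%N) := kids_children ul ke (leqnn e.+1) rings_o par_o.
suff : ~~ refuted g o'.
  have /allP := all_refuted => /(_ e); rewrite mem_iota => /(_ e5) /allP /(_ _ gf).
  by move=> /allP /(_ _ of') ->.
apply: (@not_refuted _ d e r t) => //.
- by move=> p; exact: outer_gt0.
- by move=> p q /x_lt; exact: outer_decr.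
- move=> p q uq /allP pq.
  apply: (@le_trans _ _ (rho I * outer I (x p))); last by rewrite ler_pM2r ?outer_gt0.
  rewrite -(big_map x xpredT (outer I)); apply: tail_sum_le_rho.
    rewrite map_inj_in_uniq // => a b /pq /andP[_ ae] /pq /andP[_ be] ab.
    case: (ltngtP a b) => // lt.
      by have := x_lt a b; rewrite lt be ab ltnn => /(_ isT).
    by have := x_lt b a; rewrite lt ae ab ltnn => /(_ isT).
  by apply/allP => _ /mapP[a /pq /x_lt ? ->].
- by rewrite size_mkseq.
- by rewrite size_mkseq.
- move=> k ke; have [uK K] := kid_s k ke.
  have [_ _ _ /(_ _ (av k ke))] := pls.
  by rewrite (packable_fits I _ d0 uK K) -map_comp.
- move=> k ke; have [uK K] := kid_s k ke => fit.
  apply: (nadm (decode l i k)); split; first exact: av.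
  rewrite (@packable_fits _ _ _ _ _ [seq x p | p <- rcons (kids g k) e] _ d0) -?map_comp //.
    rewrite map_rcons xe rcons_uniq uK andbT K inE.
    apply/negP => /eqP si; have : i \in placed s by rewrite inE si.
    by move/lti; rewrite ltnn.
  by move=> j; rewrite map_rcons xe mem_rcons in_cons K in_setU1.
- move=> k ke; have [uK K] := kid_o k ke.
  have avo : available o (decode l i k).
    case: (k) ke => // p pe; rewrite /=; case: plo => -> _ _ _.
    by rewrite in_setU1 -mem_enum xl ?orbT.
  have [_ _ _ /(_ _ avo)] := plo.
  by rewrite (packable_fits I _ d0 uK K) -map_comp.
Qed.

(** The lex-max scan and the greedy run take the same decision at each ring:
    placing a ring produces a placement, and skipping it means that there is
    none. *)
Lemma greedy_run_lexmax q s s' : greedy_run d I q s s' ->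
    is_placement d I (placed s) s -> sorted (fun a b : 'I_n => a < b)%N q ->
    (forall j i, j \in placed s -> i \in q -> (j < i)%N) ->
  placed s' = foldl (fun L i => if `[< feasible d I (i |: L) >] then (i |: L)%SET else L)
    (placed s) q.
Proof.
elim=> {q s s'} [//|i k q s s' adm _ IH|i q s s' nadm _ IH] pl srt lt /=.
  have pl' := admits_placement pl (fun j js => lt j i js (mem_head _ _)) adm.
  rewrite asboolT; last by exists (place s i k).
  rewrite -(placed_place s i k); apply: IH.
  - by rewrite placed_place.
  - exact: path_sorted srt.
  move=> j a; rewrite placed_place in_setU1 => /orP[/eqP ->|js] aq.
    move: srt; rewrite /= path_sortedE => [/andP[/allP /(_ _ aq)]|? ? ?] //.
    exact: ltn_trans.
  by apply: lt => //; rewrite in_cons aq orbT.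
rewrite asboolF; last first.
  case=> o plo; have [|k] := greedy_admits pl _ plo; last exact: nadm.
  by move=> j js; apply: lt => //; exact: mem_head.
apply: IH => //; first exact: path_sorted srt.
by move=> j a js aq; apply: lt => //; rewrite in_cons aq orbT.
Qed.

Lemma placed_empty : placed ([ffun=> None] : assignment n) = finset.set0.
Proof. by apply/setP => j; rewrite !inE ffunE. Qed.

Lemma empty_placement : is_placement d I (placed [ffun=> None]) [ffun=> None].
Proof.
split=> //.
- by move=> i j; rewrite ffunE.
- by move=> i; rewrite placed_empty inE.
move=> k _; apply/(packable_fits I _ d0 (s := [::])) => //.
  by move=> a; rewrite !inE ffunE.
by exists (fun=> 0); split=> // a b; rewrite ltn0 andbF.
Qed.

Lemma greedy_lexmax s : greedy_execution d I s -> placed s = lexmax d I.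
Proof.
move=> /greedy_run_lexmax -> //.
- by rewrite placed_empty.
- exact: empty_placement.
- by rewrite -(@sorted_map _ _ val ltn) val_enum_ord iota_ltn_sorted.
- by move=> j i; rewrite placed_empty inE.
Qed.

End Greedy.

(** * Instances whose ratio tends to the golden ratio *)

Lemma greedy_run_exists (R : realType) d n (I : inventory R n) q s :
  exists s', greedy_run d I q s s' /\ forall j, j \notin q -> s' j = s j.
Proof.
elim: q s => [|i q IH] s; first by exists s; split => //; exact: GreedyDone.
case: (pselect (exists k, admits d I s k i)) => [[k adm]|/forallNP nadm].
  have [s' [run same]] := IH (place s i k); exists s'; split.
    exact: GreedyPlace adm run.
  move=> j; rewrite in_cons negb_or => /andP[/negbTE ji /same ->].
  by rewrite ffunE ji.
have [s' [run same]] := IH s; exists s'; split; first exact: GreedySkip.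
by move=> j; rewrite in_cons negb_or => /andP[_ /same].
Qed.

Lemma admits_list (R : realType) d n (I : inventory R n) s k i (l : seq 'I_n) :
    (0 < d)%N -> available s k -> uniq l -> l =i (i |: children s k)%SET ->
  fits d (region I k) [seq outer I j | j <- l] -> admits d I s k i.
Proof. by move=> d0 av ul il /(packable_fits I _ d0 ul il). Qed.

Section Example.
Variables (R : realType).
Local Notation phi := (golden R).
Implicit Types (delta : R).

(** For [delta = 0] the radii are those of the equality case of [golden_crevice],
    [(1, phi - 1, 1/2, 1/2)], in a pan that the first two rings fill. Enlarging
    the last two slightly makes each of them too large for the crevice, while
    they fit in the pan together with ring 0 once ring 1 is in its hole, which
    it fills. A fifth ring, tiny, brings the number of rings to five. The bound
    [delta <= 1/40] keeps the radius of ring 2 at most [11/20], which is less than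
    that of ring 1. *)
Definition extremal_radius delta (p : nat) : R :=
  nth 0 [:: 1; phi - 1; 1 / 2 + 2 * delta; 1 / 2 + delta; delta] p.

Definition extremal_hole (p : nat) : R := if p is 0%N then phi - 1 else 0.

Lemma extremal_radius_gt0 delta : 0 < delta -> forall i : 'I_5, 0 < extremal_radius delta i.
Proof.
have /andP[lo hi] := golden_bounds R; rewrite /extremal_radius => delta_gt0.
by case=> [[|[|[|[|[|//]]]]] lt] //=; lra.
Qed.

Lemma extremal_radius_decr delta : 0 < delta -> delta <= 1 / 40 ->
  forall i j : 'I_5, (i < j)%N -> extremal_radius delta j < extremal_radius delta i.
Proof.
have /andP[lo hi] := golden_bounds R; rewrite /extremal_radius => delta_gt0 delta_small.
by case=> [[|[|[|[|[|//]]]]] lti] [[|[|[|[|[|//]]]]] ltj] //= _; lra.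
Qed.

Lemma extremal_hole_ge0 (i : 'I_5) : 0 <= extremal_hole i.
Proof.
have /andP[lo hi] := golden_bounds R; rewrite /extremal_hole.
by case: i => [[|p] lt] //=; lra.
Qed.

Lemma extremal_hole_lt_radius delta : 0 < delta ->
  forall i : 'I_5, extremal_hole i < extremal_radius delta i.
Proof.
move=> delta_gt0 i; have := extremal_radius_gt0 delta_gt0 i.
have /andP[lo hi] := golden_bounds R.
by rewrite /extremal_hole; case: i => [[|p] lt] //= _; rewrite /extremal_radius /=; lra.
Qed.

Lemma golden_gt0 : 0 < phi.
Proof. by have /andP[lo hi] := golden_bounds R; lra. Qed.

Definition extremal_inventory delta (delta_gt0 : 0 < delta) (delta_small : delta <= 1 / 40) :
    inventory R 5 :=
  @Inventory R 5 phi (fun i => extremal_radius delta i) (fun i => extremal_hole i)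
    golden_gt0 (extremal_radius_gt0 delta_gt0) (extremal_radius_decr delta_gt0 delta_small)
    extremal_hole_ge0 (extremal_hole_lt_radius delta_gt0).

Lemma rho_extremal_inventory delta (delta_gt0 : 0 < delta) (delta_small : delta <= 1 / 40) :
  rho (extremal_inventory delta_gt0 delta_small) <= phi + 8 * delta.
Proof.
have /andP[lo hi] := golden_bounds R; have phi2 := golden_sqr R.
apply: bigmax_le => [|i _]; first lra.
rewrite ler_pdivrMr; last exact: outer_gt0.
rewrite big_mkcond !big_ord_recl big_ord0 /= /bump /= /extremal_radius.
by case: i => [[|[|[|[|[|//]]]]] lti] //=; nra.
Qed.

Variables (d : nat) (d2 : (2 <= d)%N).
Let d0 : (0 < d)%N := ltnW d2.

Let i0 : 'I_5 := @Ordinal 5 0 isT.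
Let i1 : 'I_5 := @Ordinal 5 1 isT.
Let i2 : 'I_5 := @Ordinal 5 2 isT.
Let i3 : 'I_5 := @Ordinal 5 3 isT.
Let i4 : 'I_5 := @Ordinal 5 4 isT.

Let enum5 : enum 'I_5 = [:: i0; i1; i2; i3; i4].
Proof. by apply: (inj_map val_inj); rewrite val_enum_ord. Qed.

Let s0 : assignment 5 := [ffun=> None].
Let s1 := place s0 i0 None.
Let s2 := place s1 i1 None.
Let s3 := place s2 i2 (Some i0).
Let o2 := place s1 i1 (Some i0).
Let o3 := place o2 i2 None.
Let o4 := place o3 i3 None.

Local Ltac list_of_children :=
  case=> [[|[|[|[|[|//]]]]] ?] //; rewrite !inE !ffunE -!val_eqE.

Local Notation I := extremal_inventory.

Let admits_s1 delta (delta_gt0 : 0 < delta) (delta_small : delta <= 1 / 40) :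
  admits d (I delta_gt0 delta_small) s0 None i0.
Proof.
have /andP[lo hi] := golden_bounds R.
apply: (admits_list (l := [:: i0])) => //; first by list_of_children.
by apply: fits1; rewrite /= /extremal_radius /=; lra.
Qed.

Let admits_s2 delta (delta_gt0 : 0 < delta) (delta_small : delta <= 1 / 40) :
  admits d (I delta_gt0 delta_small) s1 None i1.
Proof.
have /andP[lo hi] := golden_bounds R.
apply: (admits_list (l := [:: i0; i1])) => //; first by list_of_children.
by apply: fits2; rewrite // /= /extremal_radius /=; lra.
Qed.

Let admits_s3 delta (delta_gt0 : 0 < delta) (delta_small : delta <= 1 / 40) :
  admits d (I delta_gt0 delta_small) s2 (Some i0) i2.
Proof.
have /andP[lo hi] := golden_bounds R.
apply: (admits_list (l := [:: i2])) => //.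
- by rewrite /= !inE !ffunE.
- by list_of_children.
by apply: fits1; rewrite /= /extremal_radius /=; lra.
Qed.

(** Rings 0 and 1 leave no room for ring 3 in the pan, ring 2 leaves none in the
    hole of ring 0, and the other holes are reduced to a point. *)
Let skips_i3 delta (delta_gt0 : 0 < delta) (delta_small : delta <= 1 / 40) k :
  ~ admits d (I delta_gt0 delta_small) s3 k i3.
Proof.
have /andP[lo hi] := golden_bounds R; have phi2 := golden_sqr R.
set J := I _ _; case=> _ pk.
have fits_of l : l =i (i3 |: children s3 k)%SET -> uniq l ->
    fits d (region J k) [seq outer J j | j <- l].
  by move=> il ul; apply/(packable_fits _ _ d0 ul il).
have member : outer J i3 <= region J k.
  apply: fits_mem (fits_of _ (mem_enum _) (enum_uniq _)) _.
  by apply: map_f; rewrite mem_enum !inE eqxx.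
case: k pk fits_of member => [[[|p] lt]|] /= _ fits_of member; last first.
- have /fits_of /(_ isT) : [:: i0; i1; i3] =i (i3 |: children s3 None)%SET.
    by list_of_children.
  rewrite /extremal_radius /= -[X in fits _ X](subrKC 1) => /crevice_bound.
  by move=> /(_ ltr01); nra.
- by move: member; rewrite /extremal_radius /=; lra.
have /fits_of /(_ isT) : [:: i2; i3] =i (i3 |: children s3 (Some (Ordinal lt)))%SET.
  by list_of_children.
by move=> /fits_head2; rewrite /extremal_radius /=; lra.
Qed.

Let admits_o2 delta (delta_gt0 : 0 < delta) (delta_small : delta <= 1 / 40) :
  admits d (I delta_gt0 delta_small) s1 (Some i0) i1.
Proof.
have /andP[lo hi] := golden_bounds R.
apply: (admits_list (l := [:: i1])) => //.
- by rewrite /= !inE !ffunE.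
- by list_of_children.
by apply: fits1; rewrite /= /extremal_radius /=; lra.
Qed.

Let admits_o3 delta (delta_gt0 : 0 < delta) (delta_small : delta <= 1 / 40) :
  admits d (I delta_gt0 delta_small) o2 None i2.
Proof.
have /andP[lo hi] := golden_bounds R.
apply: (admits_list (l := [:: i0; i2])) => //; first by list_of_children.
by apply: fits2; rewrite // /= /extremal_radius /=; lra.
Qed.

Let admits_o4 delta (delta_gt0 : 0 < delta) (delta_small : delta <= 1 / 40) :
  admits d (I delta_gt0 delta_small) o3 None i3.
Proof.
have /andP[lo hi] := golden_bounds R.
apply: (admits_list (l := [:: i0; i2; i3])) => //; first by list_of_children.
(* The ball of radius 1 touches the pan, and the two others are mirror images
   of each other; [22 / 25] leaves a margin on both sides. *)
apply: (@fits_dominated _ _ _ [:: 1; 11 / 20; 11 / 20]) => //.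
  by move=> [|[|[|]]] //= _; rewrite /extremal_radius /=; lra.
pose b := phi - 1.
pose c := [:: plane d (- b) 0; plane d (22 / 25) (11 / 20);
              plane d (22 / 25) (- (11 / 20))].
exists (fun p => nth 0 c p).
have inside (x y u v : R) : 0 < v -> v + u = phi -> x ^+ 2 + y ^+ 2 <= v ^+ 2 ->
    enorm (plane d x y) + u <= phi.
  by move=> v0 vu h; have := enorm_plane_le d2 (ltW v0) h; lra.
have apart (x y u v t : R) : 0 < t -> t ^+ 2 <= (x - u) ^+ 2 + (y - v) ^+ 2 ->
    t <= enorm (plane d x y - plane d u v).
  by move=> t0 h; rewrite planeB; apply: enorm_plane_ge => //; exact: ltW.
split.
  move=> [|[|[|//]]] _ /=.
  - by apply: (inside _ _ _ b); rewrite /b; lra.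
  - by apply: (inside _ _ _ (phi - 11 / 20)); nra.
  - by apply: (inside _ _ _ (phi - 11 / 20)); nra.
by apply: pairs3 => /=; apply: apart; rewrite /b; nra.
Qed.

(** The execution follows [s1], [s2], [s3]; the placements [s1], [o2], [o3], [o4]
    show that the lex-max set contains ring 3. *)
Lemma extremal_inventory_fails delta (delta_gt0 : 0 < delta) (delta_small : delta <= 1 / 40) :
  greedy_can_fail d (I delta_gt0 delta_small).
Proof.
have [s' [run same]] := greedy_run_exists d (I delta_gt0 delta_small) [:: i4] s3.
exists s'; split.
  rewrite /greedy_execution enum5.
  apply: GreedyPlace (admits_s1 delta_gt0 delta_small) _.
  apply: GreedyPlace (admits_s2 delta_gt0 delta_small) _.
  apply: GreedyPlace (admits_s3 delta_gt0 delta_small) _.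
  exact: GreedySkip (@skips_i3 _ delta_gt0 delta_small) run.
have p1 : placed s1 = (i0 |: finset.set0)%SET by rewrite placed_place placed_empty.
have p2 : placed o2 = (i1 |: (i0 |: finset.set0))%SET by rewrite placed_place p1.
have p3 : placed o3 = (i2 |: (i1 |: (i0 |: finset.set0)))%SET by rewrite placed_place p2.
have pl0 : is_placement d (I delta_gt0 delta_small) (placed s0) s0.
  exact: empty_placement.
have pl1 : is_placement d (I delta_gt0 delta_small) (placed s1) s1.
  rewrite placed_place; apply: (admits_placement d2 pl0 _ (admits_s1 _ _)) => j.
  by rewrite placed_empty inE.
have pl2 : is_placement d (I delta_gt0 delta_small) (placed o2) o2.
  rewrite placed_place; apply: (admits_placement d2 pl1 _ (admits_o2 _ _)) => j.
  by rewrite p1 !inE orbF => /eqP ->.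
have pl3 : is_placement d (I delta_gt0 delta_small) (placed o3) o3.
  rewrite placed_place; apply: (admits_placement d2 pl2 _ (admits_o3 _ _)) => j.
  by rewrite p2 !inE orbF => /orP[] /eqP ->.
have pl4 : is_placement d (I delta_gt0 delta_small) (i3 |: placed o3)%SET o4.
  apply: (admits_placement d2 pl3 _ (admits_o4 _ _)) => j.
  by rewrite p3 !inE orbF; case/or3P=> /eqP ->.
have f1 : feasible d (I delta_gt0 delta_small) (i0 |: finset.set0)%SET.
  by exists s1; rewrite -p1.
have f2 : feasible d (I delta_gt0 delta_small) (i1 |: (i0 |: finset.set0))%SET.
  by exists o2; rewrite -p2.
have f3 : feasible d (I delta_gt0 delta_small) (i2 |: (i1 |: (i0 |: finset.set0)))%SET.
  by exists o3; rewrite -p3.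
have f4 : feasible d (I delta_gt0 delta_small)
    (i3 |: (i2 |: (i1 |: (i0 |: finset.set0))))%SET.
  by exists o4; rewrite -p3.
move=> /setP /(_ i3); rewrite inE same // !ffunE /= /lexmax enum5 /=.
rewrite (asboolT f1) (asboolT f2) (asboolT f3) (asboolT f4).
by case: ifP => _; rewrite !inE.
Qed.

End Example.

Lemma tau_golden (R : realType) (d : nat) (N : set nat) : (2 <= d)%N ->
  N `<=` [set n | (n <= 5)%N] -> N 5%N -> tau R d N = (golden R)%:E.
Proof.
move=> d2 N5 N5'; apply/eqP; rewrite eq_le; apply/andP; split; last first.
  apply: le_ereal_inf_tmp => _ [_ [n [I [/N5 n5 [s [run ne]] <-]]] <-].
  rewrite lee_fin leNgt; apply/negP => /ltW le.
  exact/ne/(greedy_lexmax d2 n5 le run).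
apply/lee_addgt0Pr => eps eps0.
pose delta := Num.min (1 / 40) (eps / 8).
have delta0 : 0 < delta by rewrite lt_min divr_gt0 //=; lra.
have small : delta <= 1 / 40 by rewrite ge_min lexx.
have le8 : delta <= eps / 8 by rewrite ge_min lexx orbT.
apply: (@le_trans _ _ (rho (extremal_inventory delta0 small))%:E).
  apply: ereal_inf_lbound; exists (rho (extremal_inventory delta0 small)) => //.
  exists 5%N, (extremal_inventory delta0 small); split => //.
  exact: extremal_inventory_fails.
by rewrite -EFinD lee_fin; have := rho_extremal_inventory delta0 small; lra.
Qed.

Theorem theorem39 (R : realType) (d : nat) (hd : (2 <= d)%N) :
  [/\ forall (n : nat) (I : inventory R n) (s : assignment n),
        (n <= 5)%N -> rho I <= golden R ->
        greedy_execution d I s -> placed s = lexmax d I,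
      tau R d [set n | (n <= 5)%N] = (golden R)%:E,
      ~ failing_ratios R d [set n | (n <= 5)%N] (golden R)
    & tau R d [set n | n = 5%N] = (golden R)%:E].
Proof.
split.
- by move=> n I s n5 rho_le; exact: greedy_lexmax.
- exact: tau_golden.
- move=> [n [I [n5 [s [run ne]] rhoE]]]; apply: ne.
  by apply: greedy_lexmax => //; rewrite rhoE.
- by apply: tau_golden => // n ->.
Qed.
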